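(* Let $a_1,\dots,a_n\in\mathbb{R}^2$ ($n\ge1$), let $H:\mathbb{R}^2\to\mathbb{R}$, $H(x)=\sum_{i=1}^n\|x-a_i\|^2$, be the Hooke energy, and let $z=\frac1n\sum_{i=1}^n a_i$ be the centre of gravity. Then $$H(x)=n\|x-z\|^2+\kappa\quad\text{for all }x\in\mathbb{R}^2,\qquad \kappa=\sum_{i=1}^n\|a_i\|^2-n\|z\|^2 ,$$ so $H$ is an affine linear transform of the squared distance function to $z$. The function $H$ is minimal at the centre of gravity $z$, and $H$ and $x\mapsto\|x-z\|^2$ have the same critical point theory, i.e. the same critical points with the same indices. *)

(* Defs.v *)
From HB Require Import structures.
From mathcomp Require Import all_boot all_order all_algebra.
From mathcomp Require Import all_classical all_reals all_analysis.

Set Implicit Arguments.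
Unset Strict Implicit.
Unset Printing Implicit Defensive.

Import Order.TTheory GRing.Theory Num.Theory.
Import numFieldNormedType.Exports.

Local Open Scope ring_scope.

(* Euclidean norm; the norm `|x| that the library puts on matrices is the sup
   norm (both induce the same topology, hence the same differential calculus). *)
Definition enorm (R : realType) (d : nat) (x : 'rV[R]_d) : R :=
  Num.sqrt (\sum_(k < d) x 0 k ^+ 2).

Definition hooke_energy (R : realType) (d n : nat) (a : 'I_n -> 'rV[R]_d)
    (x : 'rV[R]_d) : R :=
  \sum_(i < n) enorm (x - a i) ^+ 2.

Definition centre_of_gravity (R : realType) (d n : nat)
    (a : 'I_n -> 'rV[R]_d) : 'rV[R]_d :=
  n%:R^-1 *: \sum_(i < n) a i.

Definition sqdist (R : realType) (d : nat) (z x : 'rV[R]_d) : R :=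
  enorm (x - z) ^+ 2.

Definition affine_transform_of (R : realType) (T : Type) (f g : T -> R) : Prop :=
  exists c b : R, c != 0 /\ forall x, f x = c * g x + b.

Definition critical_point (R : realType) (d : nat) (f : 'rV[R]_d -> R)
    (x : 'rV[R]_d) : Prop :=
  differentiable f x /\ forall v : 'rV[R]_d, 'd f x v = 0.

Definition hessian (R : realType) (d : nat) (f : 'rV[R]_d -> R)
    (x : 'rV[R]_d) : 'M[R]_d :=
  \matrix_(i < d, j < d) 'D_(delta_mx 0 i) ('D_(delta_mx 0 j) f) x.

Definition negative_definite_on (R : realType) (d : nat) (A : 'M[R]_d)
    (W : {vspace 'rV[R]_d}) : Prop :=
  forall v : 'rV[R]_d, v \in W -> v != 0 -> (v *m A *m v^T) 0 0 < 0.

(* Largest dimension of a subspace on which the Hessian form is negative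
   definite; the maximum is over a nonempty set, as k = 0 always qualifies. *)
Definition morse_index (R : realType) (d : nat) (f : 'rV[R]_d -> R)
    (x : 'rV[R]_d) : nat :=
  (\max_(k < d.+1 | `[< exists W : {vspace 'rV[R]_d},
      \dim W = k /\ negative_definite_on (hessian f x) W >]) k)%N.

(* Main.v *)
(** By the parallel axis identity [H = n |x - z|^2 + kappa] is a positive affine
    transform of the squared distance, and such a transform rescales the
    differential and the Hessian by the positive factor [n]. *)
Require Import Defs.
From HB Require Import structures.
From mathcomp Require Import all_boot all_order all_algebra.
From mathcomp Require Import all_classical all_reals all_analysis.
From mathcomp Require Import ring.

Import Order.TTheory GRing.Theory Num.Theory.
Import numFieldNormedType.Exports.

Local Open Scope ring_scope.

Lemma sqr_enorm (R : realType) (d : nat) (x : 'rV[R]_d) :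
  enorm x ^+ 2 = \sum_(k < d) x 0 k ^+ 2.
Proof. by rewrite sqr_sqrtr// sumr_ge0// => k _; exact: sqr_ge0. Qed.

(** As the [b i] sum to [n * m], the cross terms of the expanded squares add up to
    [- 2 * n * x * m]; completing the square around [m] costs [n * m ^ 2]. This is the parallel axis
    identity in a single coordinate. *)
Lemma sum_sqr_sub_mean (R : realType) (n : nat) (hn : (0 < n)%N)
    (b : 'I_n -> R) (x : R) :
  let m := n%:R^-1 * \sum_(i < n) b i in
  \sum_(i < n) (x - b i) ^+ 2 =
  n%:R * (x - m) ^+ 2 + \sum_(i < n) b i ^+ 2 - n%:R * m ^+ 2.
Proof.
move=> m; have sum_b : \sum_(i < n) b i = n%:R * m.
  by rewrite mulrA divff ?mul1r// pnatr_eq0 -lt0n.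
under eq_bigr do rewrite sqrrB.
rewrite big_split sumrB/= sumrMnl sumr_const card_ord.
by rewrite -mulr_sumr sum_b -mulr_natl; ring.
Qed.

Lemma hooke_energyE (R : realType) (d n : nat) (hn : (0 < n)%N)
    (a : 'I_n -> 'rV[R]_d) (x : 'rV[R]_d) :
  hooke_energy a x = n%:R * enorm (x - centre_of_gravity a) ^+ 2 +
    (\sum_(i < n) enorm (a i) ^+ 2 - n%:R * enorm (centre_of_gravity a) ^+ 2).
Proof.
rewrite /hooke_energy.
under eq_bigr do rewrite sqr_enorm.
under [in RHS]eq_bigr do rewrite sqr_enorm.
(* Exchanging the sums over points and coordinates splits the claim into one scalar identity per
   coordinate. *)
rewrite !sqr_enorm exchange_big [X in _ + (X - _)]exchange_big/=.
rewrite !mulr_sumr -sumrB -big_split/=; apply: eq_bigr => k _.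
under eq_bigr do rewrite !mxE.
by rewrite (sum_sqr_sub_mean _ _ hn) !mxE summxE addrA.
Qed.

Section AffineTransform.
Context {R : realType} {d : nat}.
Implicit Types (f g : 'rV[R]_d -> R) (c b : R) (x v : 'rV[R]_d).

Lemma critical_point_affine f c b x :
  critical_point f x -> critical_point (fun y => c * f y + b) x.
Proof.
move=> [df f0].
have -> : (fun y => c * f y + b) = c *: f + cst b by exact/funext.
have dcf : differentiable (c *: f) x by exact: differentiableZ.
split=> [|v]; first exact: differentiableD.
rewrite diffD//= diff_cst diffZ//=.
by rewrite f0 scaler0 addr0.
Qed.

Lemma critical_point_affineE f c b x : c != 0 ->
  critical_point (fun y => c * f y + b) x <-> critical_point f x.
Proof.
move=> c0; split; last exact: critical_point_affine.
(* The converse is the forward direction for the inverse map [t |-> c^-1 * t - c^-1 * b], which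
   recovers [f]. *)
move=> /(critical_point_affine _ c^-1 (- (c^-1 * b))).
congr critical_point; apply/funext => y.
by rewrite mulrDr addrK mulKf.
Qed.

Lemma derivable_affine f c b x v :
  derivable f x v -> derivable (fun y => c * f y + b) x v.
Proof.
move=> df.
have -> : (fun y => c * f y + b) = c *: f + cst b by exact/funext.
by apply: derivableD; [exact: derivableZ|exact: derivable_cst].
Qed.

(* No derivability is needed: for [c != 0] both sides are the junk value [0]
   when [f] has no derivative along [v]. *)
Lemma derive_affine f c b x v : c != 0 ->
  'D_v (fun y => c * f y + b) x = c * 'D_v f x.
Proof.
move=> c0; have [df|ndf] := pselect (derivable f x v).
  have -> : (fun y => c * f y + b) = c *: f + cst b by exact/funext.
  rewrite deriveD ?deriveZ ?derive_cst ?addr0//; exact: derivableZ.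
have ndcf : ~ derivable (fun y => c * f y + b) x v.
  move=> /(derivable_affine _ c^-1 (- (c^-1 * b))) dcf; apply: ndf.
  rewrite (_ : f = fun y => c^-1 * (c * f y + b) - c^-1 * b)//.
  by apply/funext => y; rewrite mulrDr addrK mulKf.
by rewrite /derive (dvgP ndf) (dvgP ndcf) mulr0.
Qed.

Lemma hessian_affine f c b x : c != 0 ->
  hessian (fun y => c * f y + b) x = c *: hessian f x.
Proof.
move=> c0; apply/matrixP => i j; rewrite !mxE.
(* The shift [0] puts the inner derivative back into affine form, so that [derive_affine] applies a
   second time. *)
have -> : 'D_(delta_mx 0 j) (fun y => c * f y + b) =
    fun y => c * 'D_(delta_mx 0 j) f y + 0.
  by apply/funext => y; rewrite derive_affine// addr0.
exact: derive_affine.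
Qed.

(** A positive factor keeps the sign of the Hessian form on every vector, so the same subspaces
    compete for the maximal dimension; a negative factor would turn negative definite into positive
    definite. *)
Lemma morse_index_affine f c b x : 0 < c ->
  morse_index (fun y => c * f y + b) x = morse_index f x.
Proof.
move=> c0; rewrite /morse_index hessian_affine ?gt_eqF//.
have ndE W : negative_definite_on (c *: hessian f x) W <->
    negative_definite_on (hessian f x) W.
  have formE v : (v *m (c *: hessian f x) *m v^T) 0 0 =
      c * (v *m hessian f x *m v^T) 0 0.
    by rewrite -scalemxAr -scalemxAl [LHS]mxE.
  by split=> nd v vW v0; move: (nd v vW v0); rewrite formE pmulr_rlt0.
apply: eq_bigl => k; apply: asbool_equiv_eq.
by split=> -[W [Wk /ndE ndW]]; exists W.
Qed.

End AffineTransform.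

Theorem proposition8 (R : realType) (n : nat) (hn : (1 <= n)%N)
    (a : 'I_n -> 'rV[R]_2) :
  let H : 'rV[R]_2 -> R := hooke_energy a in
  let z : 'rV[R]_2 := centre_of_gravity a in
  let kappa : R := \sum_(i < n) enorm (a i) ^+ 2 - n%:R * enorm z ^+ 2 in
  [/\ forall x : 'rV[R]_2, H x = n%:R * enorm (x - z) ^+ 2 + kappa,
      affine_transform_of H (sqdist z),
      forall x : 'rV[R]_2, H z <= H x,
      forall x : 'rV[R]_2, critical_point H x <-> critical_point (sqdist z) x
    & forall x : 'rV[R]_2, critical_point H x ->
        morse_index H x = morse_index (sqdist z) x].
Proof.
move=> H z kappa.
have n0 : 0 < n%:R :> R by rewrite ltr0n.
have nN0 : n%:R != 0 :> R by rewrite gt_eqF.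
have HE x : H x = n%:R * sqdist z x + kappa by exact: hooke_energyE.
(* Critical points and indices depend on [H] as a function, so the pointwise identity is lifted by
   extensionality. *)
have HEf : H = fun x => n%:R * sqdist z x + kappa by exact/funext.
split=> [//| |x|x|x _].
- by exists n%:R, kappa.
(* Cancelling [kappa] and the positive factor [n] leaves [sqdist z z <= sqdist z x], whose left side
   vanishes. *)
- rewrite !HE lerD2r ler_pM2l// /sqdist subrr sqr_enorm big1 ?sqr_ge0// => k _.
  by rewrite mxE expr0n.
- by rewrite HEf; exact: critical_point_affineE.
- by rewrite HEf; exact: morse_index_affine.
Qed.
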